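(* Let $p>3$ be a prime, $f(x)\in\mathbb{Z}[x]$, and let $\sigma$ be a cycle of $f_1$ (i.e. of $f$ mod $p$) which grows. Then its unique lift, a cycle of $f_2$, also grows.
   Context: $f_n:\mathbb{Z}/p^n\mathbb{Z}\to\mathbb{Z}/p^n\mathbb{Z}$ is the map $x\mapsto f(x)\bmod p^n$. Let $\sigma=(x_1,\dots,x_k)$ be a cycle of $f_n$ of length $k$ (distinct elements, $f_n(x_i)=x_{i+1}$, $f_n(x_k)=x_1$), with the $x_i$ viewed as integers representing their classes. Put $g=f^k$ ($k$-th iterate), $a_n=g'(x_1)$, $b_n=(g(x_1)-x_1)/p^n$. A lift of $\sigma$ is a cycle of $f_{n+1}$ all of whose elements reduce mod $p^n$ to elements of $\sigma$. The cycle $\sigma$ grows if $a_n\equiv1\pmod p$ and $b_n\not\equiv0\pmod p$ (this is independent of the choices); in that case the elements of $\mathbb{Z}/p^{n+1}\mathbb{Z}$ reducing to elements of $\sigma$ form a single cycle of $f_{n+1}$, of length $pk$, which is the unique lift of $\sigma$. *)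

(* Defs.v *)
From mathcomp Require Import all_boot all_order all_algebra.

Import GRing.Theory.
Local Open Scope ring_scope.

(* Z/p^nZ is rendered as 'Z_(p ^ n), which is that ring only when 1 < p ^ n;
   everything below is meant for p prime and n >= 1. *)

(* The representative of a class in {0, ..., p^n - 1}, as an integer. *)
Definition rep (p n : nat) (x : 'Z_(p ^ n)) : int := (nat_of_ord x)%:Z.

Definition fmod (p n : nat) (f : {poly int}) (x : 'Z_(p ^ n)) : 'Z_(p ^ n) :=
  (f.[rep p n x])%:~R.

(* The cycle (x_1, ..., x_k) is the sequence [:: x_1; ...; x_k]; sequences that
   differ by a rotation describe the same cycle. The test s != [::] is needed
   since fcycle holds of the empty sequence. *)
Definition is_cycle (p n : nat) (f : {poly int}) (s : seq 'Z_(p ^ n)) : bool :=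
  [&& s != [::], uniq s & fcycle (fmod p n f) s].

Definition reduce (p n : nat) (y : 'Z_(p ^ n.+1)) : 'Z_(p ^ n) :=
  (rep p n.+1 y)%:~R.

Definition is_lift (p n : nat) (f : {poly int})
    (s : seq 'Z_(p ^ n)) (t : seq 'Z_(p ^ n.+1)) : bool :=
  is_cycle p n.+1 f t && all (fun y => reduce p n y \in s) t.

Definition poly_iter (f : {poly int}) (k : nat) : {poly int} :=
  iter k (fun q => f \Po q) 'X.

Definition first (p n : nat) (s : seq 'Z_(p ^ n)) : int :=
  rep p n (head (0 : 'Z_(p ^ n)) s).

Definition cycle_a (p n : nat) (f : {poly int}) (s : seq 'Z_(p ^ n)) : int :=
  (poly_iter f (size s))^`().[first p n s].

(* The division is exact when s is a cycle of f modulo p^n. *)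
Definition cycle_b (p n : nat) (f : {poly int}) (s : seq 'Z_(p ^ n)) : int :=
  (((poly_iter f (size s)).[first p n s] - first p n s) %/ (p ^ n)%N%:Z)%Z.

Definition grows (p n : nat) (f : {poly int}) (s : seq 'Z_(p ^ n)) : bool :=
  (cycle_a p n f s == 1 %[mod p%:Z])%Z && (cycle_b p n f s != 0 %[mod p%:Z])%Z.

(* Main.v *)
(** Let g = f^k, where k is the length of the cycle, and let y reduce into the
    cycle. Taylor's formula to order 3 at y gives, with g(y) = y + p b,
    g'(y) = 1 + p alpha and c = g''(y) / 2,
      g^j(y) = y + p j b
               + p^2 (alpha b sum_(i < j) i + c b^2 sum_(i < j) i^2)  mod p^3.
    Modulo p^2 only p j b remains: as p does not divide b, the points over the
    cycle form a single orbit, of length p k. For j = p > 3 both sums are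
    divisible by p, so g^p(y) - y = p^2 b mod p^3, which is not 0. *)
Require Import Defs.
From mathcomp Require Import all_boot all_order all_algebra.
From mathcomp Require Import zify ring.

Import GRing.Theory Num.Theory.

(** * Cycles of a self-map of a finite type *)

Section FiniteCycle.

Variables (T : finType) (f : T -> T).

(** The order of [x] is [size s], so [m] may be reduced modulo [size s]; an exponent below the order
    is recovered from its iterate by [findex], and for [x] itself it is 0. *)
Lemma fcycle_iter_eq (s : seq T) (x : T) (m : nat) :
  fcycle f s -> uniq s -> x \in s -> (iter m f x == x) = (size s %| m).
Proof.
move=> fs us xs; have os : order f x = size s by rewrite (order_cycle fs).
have itx : iter (size s) f x = x by rewrite -os; exact: (iter_order_cycle fs xs xs).
have itq q : iter (q * size s) f x = x.
  by elim: q => // q IH; rewrite mulSn iterD IH itx.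
rewrite {1}(divn_eq m (size s)) addnC iterD itq /dvdn.
have rlt : m %% size s < order f x by rewrite os ltn_pmod // -os order_gt0.
apply/eqP/eqP => [e|->//].
by rewrite -(findex_iter rlt) e findex0.
Qed.

Lemma fcycle_mem_iter (s : seq T) (x y : T) :
  fcycle f s -> x \in s -> (y \in s) <-> exists m, y = iter m f x.
Proof.
move=> fs xs; rewrite -(fconnect_cycle fs xs); split.
  by move=> c; exists (findex f x y); rewrite iter_findex.
by case=> m ->; apply: fconnect_iter.
Qed.

End FiniteCycle.

Local Open Scope ring_scope.

(** * Taylor expansions with polynomial remainder *)

Lemma horner_taylor1 (R : comNzRingType) (g : {poly R}) (y : R) :
  exists q : {poly R}, q.[y] = g^`().[y] /\
    forall z, g.[z] = g.[y] + (z - y) * q.[z].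
Proof.
have /factor_theorem [q gE] : root (g - g.[y]%:P) y.
  by rewrite /root !hornerE subrr.
exists q; split=> [|z].
  (* Differentiating the factorization at [y] identifies q(y) with g'(y). *)
  have := congr1 (fun h : {poly R} => h^`().[y]) gE.
  by rewrite !derivE !hornerE subrr mulr0 add0r subr0 => ->.
have := congr1 (fun h : {poly R} => h.[z]) gE.
by rewrite !hornerE => /eqP; rewrite subr_eq => /eqP ->; ring.
Qed.

Lemma horner_taylor2 (R : comNzRingType) (g : {poly R}) (y : R) :
  exists q : {poly R}, forall z,
    g.[z] = g.[y] + (z - y) * g^`().[y] + (z - y) ^+ 2 * q.[z].
Proof.
have [q [qy gE]] := horner_taylor1 _ g y.
have [r [_ qE]] := horner_taylor1 _ q y.
by exists r => z; rewrite gE qE qy; ring.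
Qed.

(** Here [c] plays the role of g''(y)/2; as a value of a quotient polynomial it requires no division
    by 2. *)
Lemma horner_taylor3 (R : comNzRingType) (g : {poly R}) (y : R) :
  exists (c : R) (q : {poly R}), forall z,
    g.[z] = g.[y] + (z - y) * g^`().[y] + (z - y) ^+ 2 * c
            + (z - y) ^+ 3 * q.[z].
Proof.
have [q gE] := horner_taylor2 _ g y.
have [r [_ qE]] := horner_taylor1 _ q y.
by exists q.[y], r => z; rewrite gE qE; ring.
Qed.

Lemma dvdz_horner_sub (d : int) (g : {poly int}) (y z : int) :
  (d %| z - y)%Z -> (d %| g.[z] - g.[y])%Z.
Proof.
move=> dzy; have [q [_ ->]] := horner_taylor1 _ g y.
by rewrite addrC addKr dvdz_mulr.
Qed.

(** * Integer iterates of f and the chain rule *)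

Section PolyIter.

Variable f : {poly int}.

Lemma horner_poly_iter (k : nat) (z : int) :
  (poly_iter f k).[z] = iter k (horner f) z.
Proof.
elim: k => [|k IH]; first by rewrite /= hornerX.
by rewrite /poly_iter iterS horner_comp IH.
Qed.

Lemma deriv_poly_iterS (k : nat) (z : int) :
  (poly_iter f k.+1)^`().[z] =
  f^`().[iter k (horner f) z] * (poly_iter f k)^`().[z].
Proof.
by rewrite /poly_iter iterS deriv_comp hornerM horner_comp horner_poly_iter.
Qed.

Lemma deriv_poly_iterD (a b : nat) (z : int) :
  (poly_iter f (a + b))^`().[z] =
  (poly_iter f a)^`().[iter b (horner f) z] * (poly_iter f b)^`().[z].
Proof.
elim: a => [|a IH]; first by rewrite add0n derivX hornerC mul1r.
by rewrite addSn !deriv_poly_iterS IH iterD mulrA.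
Qed.

Lemma deriv_poly_iterSr (k : nat) (z : int) :
  (poly_iter f k.+1)^`().[z] = (poly_iter f k)^`().[f.[z]] * f^`().[z].
Proof.
by rewrite -addn1 deriv_poly_iterD deriv_poly_iterS derivX hornerC mulr1.
Qed.

Lemma dvdz_iter_sub (d : int) (k : nat) (y z : int) :
  (d %| z - y)%Z -> (d %| iter k (horner f) z - iter k (horner f) y)%Z.
Proof. by rewrite -!horner_poly_iter; apply: dvdz_horner_sub. Qed.

End PolyIter.

(** * Power sums, with denominators cleared *)

Lemma sum_id_int (n : nat) : 2 * \sum_(i < n) i%:Z = n%:Z * (n%:Z - 1).
Proof.
elim: n => [|n IH]; first by rewrite big_ord0 mulr0 mul0r.
by rewrite big_ord_recr /= mulrDr IH intS; ring.
Qed.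

Lemma sum_sqr_int (n : nat) :
  6 * \sum_(i < n) i%:Z ^+ 2 = n%:Z * ((n%:Z - 1) * (2 * n%:Z - 1)).
Proof.
elim: n => [|n IH]; first by rewrite big_ord0 mulr0 mul0r.
by rewrite big_ord_recr /= mulrDr IH intS; ring.
Qed.

(** * Growth at an integer point *)

Section GrowsAt.

Variables (p : nat) (f : {poly int}).

(** Growth without reference to a cycle and without division: that p does not divide b_n becomes a
    statement modulo p^(n+1), meaningful at every integer z. *)
Definition grows_at (n k : nat) (z : int) :=
  [/\ (p%:Z ^+ n %| (poly_iter f k).[z] - z)%Z,
      ~~ (p%:Z ^+ n.+1 %| (poly_iter f k).[z] - z)%Z
    & (p %| (poly_iter f k)^`().[z] - 1)%Z].

Hypothesis p_prime : prime p.

Let p_neq0 : p%:Z != 0.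
Proof. by rewrite eqz_nat -lt0n prime_gt0. Qed.

Lemma dvdz_prime_mul (a b : int) : (p %| a * b)%Z = (p %| a)%Z || (p %| b)%Z.
Proof. by rewrite !dvdzE abszM Euclid_dvdM. Qed.

Lemma dvdz_expS_mul (n : nat) (a : int) :
  (p%:Z ^+ n.+1 %| p%:Z ^+ n * a)%Z = (p %| a)%Z.
Proof. by rewrite exprSr dvdz_mul2l // expf_neq0. Qed.

(** Independence of the representative: for z' = z + u p^n, the congruence g'(z) = 1 mod p cancels
    the linear terms in u, and n > 0 puts the quadratic one in p^(n+1). *)
Lemma grows_at_congr (n k : nat) (z z' : int) : (0 < n)%N ->
  grows_at n k z -> (p%:Z ^+ n %| z' - z)%Z -> grows_at n k z'.
Proof.
case: n => // n _; rewrite /grows_at; set g := poly_iter f k.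
case=> /dvdzP [b gb] nb /dvdzP [a ga] /dvdzP [u zu].
have [q gE] := horner_taylor2 _ g z.
have key : g.[z'] - z' =
    p%:Z ^+ n.+1 * (b + p%:Z * (u * a + p%:Z ^+ n * u ^+ 2 * q.[z'])).
  rewrite gE zu; have -> : g^`().[z] = a * p + 1 by rewrite -ga; ring.
  have -> : g.[z] = b * p%:Z ^+ n.+1 + z by rewrite -gb; ring.
  have -> : z' = u * p%:Z ^+ n.+1 + z by rewrite -zu; ring.
  by rewrite exprS; ring.
split.
- by rewrite key dvdz_mulr.
- rewrite key dvdz_expS_mul rpredDr ?dvdz_mulr //.
  by move: nb; rewrite gb mulrC dvdz_expS_mul.
- have -> : g^`().[z'] - 1 = (g^`().[z'] - g^`().[z]) + (g^`().[z] - 1) by ring.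
  rewrite ga rpredD ?dvdz_mull // dvdz_horner_sub // zu dvdz_mull //.
  by rewrite exprS dvdz_mulr.
Qed.

(** Since g commutes with f, Taylor's formula for f at z multiplies b by f'(z) modulo p. This is a
    unit, being a factor of g'(z) = 1 mod p. *)
Lemma grows_at_horner (n k : nat) (z : int) : (0 < n)%N -> (0 < k)%N ->
  grows_at n k z -> grows_at n k f.[z].
Proof.
case: n => // n _ k_gt0; rewrite /grows_at; set g := poly_iter f k.
case=> /dvdzP [b gb] nb ga.
have nb' : ~~ (p %| b)%Z by move: nb; rewrite gb mulrC dvdz_expS_mul.
have nf : ~~ (p %| f^`().[z])%Z.
  apply/negP => pf.
  have : (p %| g^`().[z])%Z.
    by rewrite /g -(prednK k_gt0) deriv_poly_iterSr dvdz_mull.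
  have -> : g^`().[z] = 1 + (g^`().[z] - 1) by ring.
  by rewrite rpredDr // dvdzE /= dvdn1; case: eqP p_prime => // ->.
have gf : g.[f.[z]] = f.[g.[z]].
  by rewrite !horner_poly_iter -iterSr iterS.
have [q fE] := horner_taylor2 _ f z.
have key : g.[f.[z]] - f.[z] =
    p%:Z ^+ n.+1 * (b * (f^`().[z] + p%:Z * (p%:Z ^+ n * b * q.[g.[z]]))).
  by rewrite gf fE gb exprS; ring.
split.
- by rewrite key dvdz_mulr.
- rewrite key dvdz_expS_mul.
  by rewrite dvdz_prime_mul (negPf nb') /= rpredDr // dvdz_mulr.
(* The chain rule on both sides of g(f(X)) = f(g(X)) compares the derivatives; the unit f'(z) is
   then cancelled. *)
- have : (p %| (g^`().[f.[z]] - 1) * f^`().[z])%Z.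
    have -> : (g^`().[f.[z]] - 1) * f^`().[z] =
              (f^`().[g.[z]] - f^`().[z]) * g^`().[z]
              + f^`().[z] * (g^`().[z] - 1).
      rewrite mulrBl /g -deriv_poly_iterSr deriv_poly_iterS horner_poly_iter.
      by ring.
    rewrite rpredD ?(dvdz_mull _ ga) // dvdz_mulr // dvdz_horner_sub //.
    by rewrite gb dvdz_mull // exprS dvdz_mulr.
  by rewrite dvdz_prime_mul (negPf nf) orbF.
Qed.

Lemma grows_at_iter (n k i : nat) (z : int) : (0 < n)%N -> (0 < k)%N ->
  grows_at n k z -> grows_at n k (iter i (horner f) z).
Proof. by move=> n0 k0 gz; elim: i => // i IH; apply: grows_at_horner. Qed.

(* Rescaling by y + pX turns f^k into X + b + p(alpha X + c X^2) modulo p^2. *)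
Lemma iter_grows_at_expansion (k : nat) (y : int) : grows_at 1 k y ->
  exists b alpha c : int, ~~ (p %| b)%Z /\
    forall j, exists e, iter (j * k) (horner f) y =
      y + p%:Z * (j%:Z * b)
        + p%:Z ^+ 2 * (alpha * b * \sum_(i < j) i%:Z
                       + c * b ^+ 2 * \sum_(i < j) i%:Z ^+ 2)
        + p%:Z ^+ 3 * e.
Proof.
rewrite /grows_at; set g := poly_iter f k.
case=> /dvdzP [b gb] nb /dvdzP [a ga].
have [c [q gE]] := horner_taylor3 _ g y.
exists b, a, c; split; first by move: nb; rewrite gb mulrC dvdz_expS_mul.
elim=> [|j [e IH]]; first by exists 0; rewrite !big_ord0 /=; ring.
rewrite mulSn iterD -horner_poly_iter -/g !big_ord_recr /=.
move: IH; set A := \sum_(i < j) _; set B := \sum_(i < j) _.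
set w := iter (j * k) _ y => IH.
have a1 : g^`().[y] = a * p + 1 by rewrite -ga; ring.
have g1 : g.[y] = b * p + y by rewrite -[b * p]gb; ring.
set S := a * b * A + c * b ^+ 2 * B + p%:Z * e.
have wy : w - y = p%:Z * (j%:Z * b + p%:Z * S) by rewrite IH /S; ring.
(* These are the terms of order p^3 in Taylor's formula at [w]; those of order p^2 extend the two
   sums by j and j^2. *)
exists (e + a * S + c * (2 * j%:Z * b * S + p%:Z * S ^+ 2)
        + (j%:Z * b + p%:Z * S) ^+ 3 * q.[w]).
by rewrite gE wy a1 g1 intS /S; ring.
Qed.

Lemma iter_grows_at_mod2 (k : nat) (y : int) : grows_at 1 k y ->
  exists b : int, ~~ (p %| b)%Z /\
    forall j, (p%:Z ^+ 2 %|
                 iter (j * k) (horner f) y - (y + p%:Z * (j%:Z * b)))%Z.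
Proof.
move=> /iter_grows_at_expansion [b [a [c [nb H]]]]; exists b; split=> // j.
have [e ->] := H j; set S := _ + c * _ * _.
apply/dvdzP; exists (S + p%:Z * e); ring.
Qed.

(** Modulo p^2 the displacement is p j b with b prime to p; this yields the length p k of the
    lift. *)
Lemma iter_grows_at_dvd (k j : nat) (y : int) : grows_at 1 k y ->
  (p%:Z ^+ 2 %| iter (j * k) (horner f) y - y)%Z = (p %| j)%N.
Proof.
move=> /iter_grows_at_mod2 [b [nb /(_ j) H]].
set w := iter _ _ _ in H *.
have -> : w - y = w - (y + p%:Z * (j%:Z * b)) + p%:Z ^+ 1 * (j%:Z * b) by ring.
by rewrite rpredDl // dvdz_expS_mul dvdz_prime_mul (negPf nb) orbF.
Qed.

(** By the chain rule the derivative is a product of values of g' at points congruent to y modulo p,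
    each congruent to 1. *)
Lemma deriv_iter_grows_at (k j : nat) (y : int) : grows_at 1 k y ->
  (p %| (poly_iter f (j * k))^`().[y] - 1)%Z.
Proof.
move=> gy; have [_ _ ga] := gy.
elim: j => [|j IH]; first by rewrite /= derivX hornerE subrr dvdz0.
rewrite mulSn deriv_poly_iterD; set w := iter _ _ _.
set d := _.[y] in IH *; set g := poly_iter f k in ga *.
have -> : g^`().[w] * d - 1 =
    ((g^`().[w] - g^`().[y]) + (g^`().[y] - 1)) * d + (d - 1) by ring.
rewrite rpredD // dvdz_mulr // rpredD // dvdz_horner_sub //.
have [b [_ /(_ j) H]] := iter_grows_at_mod2 _ _ gy.
rewrite -/w in H.
have -> : w - y = w - (y + p%:Z * (j%:Z * b)) + p%:Z * (j%:Z * b) by ring.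
rewrite rpredD ?dvdz_mulr //; apply: dvdz_trans H.
by rewrite expr2 dvdz_mulr.
Qed.

Lemma grows_at_pmul (k : nat) (y : int) : (3 < p)%N ->
  grows_at 1 k y -> grows_at 2 (p * k) y.
Proof.
move=> p3 gy; split; last exact: deriv_iter_grows_at.
  by rewrite horner_poly_iter iter_grows_at_dvd.
(* The condition p > 3 makes 2 and 6 invertible modulo p, so the closed forms show that p divides
   both sums. *)
have p2 : (p %| 2)%Z = false.
  by apply/negbTE/negP; rewrite dvdzE => /dvdn_leq; lia.
have p3' : (p %| 3)%Z = false.
  by apply/negbTE/negP; rewrite dvdzE => /dvdn_leq; lia.
have s1 : (p %| \sum_(i < p) i%:Z)%Z.
  have : (p %| 2 * \sum_(i < p) i%:Z)%Z by rewrite sum_id_int dvdz_mulr.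
  by rewrite dvdz_prime_mul p2.
have s2 : (p %| \sum_(i < p) i%:Z ^+ 2)%Z.
  have : (p %| 6 * \sum_(i < p) i%:Z ^+ 2)%Z by rewrite sum_sqr_int dvdz_mulr.
  by rewrite (_ : 6 = 2 * 3) // !dvdz_prime_mul p2 p3'.
have [b [a [c [nb /(_ p) [e H]]]]] := iter_grows_at_expansion _ _ gy.
rewrite horner_poly_iter {}H.
move: s1 s2; set A := \sum_(i < p) _; set B := \sum_(i < p) _.
move=> /dvdzP [A' ->] /dvdzP [B' ->].
set X := (X in (_ %| X)%Z).
have -> : X = p%:Z ^+ 2 * (b + p%:Z * (a * b * A' + c * b ^+ 2 * B' + e)).
  by rewrite /X; ring.
by rewrite dvdz_expS_mul rpredDr // dvdz_mulr.
Qed.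

End GrowsAt.

(** * From residue classes to integer congruences *)

Lemma intr_Zp_eq (N : nat) (z w : int) : (1 < N)%N ->
  (z%:~R == w%:~R :> 'Z_N) = (N %| z - w)%Z.
Proof.
move=> N1; rewrite -subr_eq0 -rmorphB dvdzE /=; move: (z - w) => d.
have nat0 m : (m%:R == 0 :> 'Z_N) = (N %| m)%N.
  by rewrite -val_eqE /= val_Zp_nat.
by case: d => m; rewrite ?NegzE ?rmorphN ?oppr_eq0; apply: nat0.
Qed.

Section Reduction.

Variables (p n : nat) (f : {poly int}).
Hypothesis pn_gt1 : (1 < p ^ n)%N.

Lemma rep_intr (x : 'Z_(p ^ n)) : (rep p n x)%:~R = x.
Proof. by rewrite /rep -pmulrn natr_Zp. Qed.

Lemma intr_Zpn_eq (z w : int) :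
  (z%:~R == w%:~R :> 'Z_(p ^ n)) = (p%:Z ^+ n %| z - w)%Z.
Proof. by rewrite intr_Zp_eq // -natz natrX natz. Qed.

(** Polynomials respect congruences, so any integer representative may replace the canonical one
    used by [fmod]. *)
Lemma fmod_intr (z : int) : fmod p n f z%:~R = (f.[z])%:~R.
Proof.
apply/eqP; rewrite intr_Zpn_eq dvdz_horner_sub // -intr_Zpn_eq.
by rewrite rep_intr.
Qed.

Lemma iter_fmod_intr (m : nat) (z : int) :
  iter m (fmod p n f) z%:~R = (iter m (horner f) z)%:~R.
Proof. by elim: m => // m IH; rewrite !iterS IH fmod_intr. Qed.

Lemma first_intr (s : seq 'Z_(p ^ n)) :
  s != [::] -> (first p n s)%:~R \in s.
Proof. by case: s => // x s _; rewrite /first rep_intr inE eqxx. Qed.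

Lemma is_cycle_iter_eq (s : seq 'Z_(p ^ n)) (m : nat) (z : int) :
  is_cycle p n f s -> z%:~R \in s ->
  (p%:Z ^+ n %| iter m (horner f) z - z)%Z = (size s %| m)%N.
Proof.
case/and3P=> _ us fs zs.
by rewrite -intr_Zpn_eq -iter_fmod_intr (fcycle_iter_eq _ _ _ _ _ fs us zs).
Qed.

(** The cycle closes modulo p^n, so the division in [cycle_b] is exact and can be undone by
    multiplying by p^n. *)
Lemma growsP (s : seq 'Z_(p ^ n)) : is_cycle p n f s ->
  grows p n f s <-> grows_at p f n (size s) (first p n s).
Proof.
move=> cs; have s0 : s != [::] by case/and3P: cs.
have := is_cycle_iter_eq _ (size s) _ cs (first_intr _ s0).
rewrite dvdnn -horner_poly_iter => d.
rewrite /grows /grows_at /cycle_a /cycle_b !eqz_mod_dvd subr0.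
have pnZ : (p ^ n)%N%:Z = p%:Z ^+ n by rewrite -natz natrX natz.
have pn0 : p%:Z ^+ n != 0 by rewrite -pnZ; lia.
rewrite pnZ; case/dvdzP: (d) => b ->; rewrite mulzK // exprSr mulrC.
rewrite (dvdz_mul2l pn0) dvdz_mulr //.
by split=> [/andP [-> ->] | [_ -> ->]].
Qed.

End Reduction.

Lemma reduce_intr (p n : nat) (z : int) : (1 < p)%N -> (0 < n)%N ->
  reduce p n z%:~R = z%:~R.
Proof.
move=> p1 n0; have q1 m : (0 < m)%N -> (1 < p ^ m)%N.
  by move=> ?; rewrite -(exp1n m) ltn_exp2r.
apply/eqP; rewrite intr_Zpn_eq ?q1 //.
have : (p%:Z ^+ n.+1 %| rep p n.+1 z%:~R - z)%Z.
  by rewrite -intr_Zpn_eq ?q1 // rep_intr ?q1.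
by apply: dvdz_trans; rewrite exprSr dvdz_mulr.
Qed.

(** Bezout gives an inverse w of b modulo p; the remainder of w u modulo p is a natural number that
    serves as j. *)
Lemma exists_natmul_mod (p : nat) (b u : int) : prime p -> ~~ (p %| b)%Z ->
  exists j : nat, (p %| j%:Z * b - u)%Z.
Proof.
move=> pp nb; have p0 : p%:Z != 0 by have := prime_gt0 pp; lia.
have : coprimez p b by rewrite coprimezE /= prime_coprime.
case/coprimezP=> -[v w] /= bez.
have [q qE] : exists q : int, ((w * u) %% p)%Z = w * u - q * p.
  by exists ((w * u) %/ p)%Z; rewrite {2}(divz_eq (w * u) p); ring.
exists `|((w * u) %% p)%Z|%N; rewrite gez0_abs ?modz_ge0 // qE.
apply/dvdzP; exists (- (v * u) - q * b).
have -> : (w * u - q * p) * b - u = u * (w * b - 1) - q * b * p by ring.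
have -> : w * b = 1 - v * p by rewrite -bez; ring.
by ring.
Qed.

(** * Lifts of a growing cycle modulo p *)

Section Lift.

Variables (p : nat) (f : {poly int}) (s : seq 'Z_(p ^ 1)).
Hypotheses (p_prime : prime p) (s_cycle : is_cycle p 1 f s).
Hypothesis s_grows : grows p 1 f s.

Let k := size s.

Let p_gt1 : (1 < p)%N. Proof. exact: prime_gt1. Qed.
Let p1_gt1 : (1 < p ^ 1)%N. Proof. by rewrite expn1. Qed.
Let p2_gt1 : (1 < p ^ 2)%N. Proof. by rewrite -(exp1n 2) ltn_exp2r. Qed.
Let k_gt0 : (0 < k)%N.
Proof. by rewrite lt0n size_eq0; case/and3P: s_cycle. Qed.

(** Growth is carried from the first element along the orbit, then to another representative. *)
Lemma cycle_grows_at (z : int) : z%:~R \in s -> grows_at p f 1 k z.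
Proof.
have /and3P [s0 us fs] := s_cycle.
move=> /(fcycle_mem_iter _ _ _ _ _ fs (first_intr _ _ _ s0)) [m /eqP].
rewrite iter_fmod_intr // intr_Zpn_eq // => zE.
apply: grows_at_congr zE => //; apply: grows_at_iter => //.
exact/growsP.
Qed.

(** From a point of the lift, [m] steps reach the class of [z] modulo p; further turns around the
    cycle then correct the digit of p. *)
Lemma lift_mem (t : seq 'Z_(p ^ 2)) (z : int) :
  is_lift p 1 f s t -> z%:~R \in s -> z%:~R \in t.
Proof.
case/andP=> /and3P [t0 ut ft] /allP ts zs; have /and3P [s0 us fs] := s_cycle.
have yt := first_intr _ _ _ t0; set y := first p 2 t in yt.
have := ts _ yt; rewrite reduce_intr // => ys.
have /(fcycle_mem_iter _ _ _ _ _ fs ys) [m /eqP] := zs.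
rewrite iter_fmod_intr // intr_Zpn_eq // => /dvdzP [u zE].
set w := iter m (horner f) y in zE.
have gw : grows_at p f 1 k w by apply: grows_at_iter => //; apply: cycle_grows_at.
have [b [nb itw]] := iter_grows_at_mod2 _ _ p_prime _ _ gw.
(* With z = w + p u, [j] turns add p j b modulo p^2, so [j] must solve j b = u mod p. *)
have [j /dvdzP [e je]] := exists_natmul_mod _ _ u p_prime nb.
apply/(fcycle_mem_iter _ _ _ _ _ ft yt); exists (j * k + m)%N; apply/eqP.
rewrite iter_fmod_intr // intr_Zpn_eq // iterD -/w.
have := itw j; set v := iter _ _ _ => vE.
have -> : z - v = p%:Z ^+ 2 * - e - (v - (w + p%:Z * (j%:Z * b))).
  have -> : z = u * p + w by rewrite -[u * p]zE; ring.
  have -> : j%:Z * b = e * p + u by rewrite -je; ring.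
  by ring.
by rewrite rpredB // dvdz_mulr.
Qed.

Lemma orbit_is_lift (z : int) : z%:~R \in s ->
  is_lift p 1 f s (orbit (fmod p 2 f) z%:~R).
Proof.
move=> zs; have /and3P [s0 us fs] := s_cycle.
have gz := cycle_grows_at _ zs.
apply/andP; split.
  apply/and3P; split; first by rewrite -size_eq0 size_orbit -lt0n order_gt0.
    exact: orbit_uniq.
  (* An orbit is a cycle once its start recurs after a positive number of steps, here p k; the
     criterion counts them as a successor, hence the predecessor. *)
  apply/(orbitPcycle 3 0); exists (p * k).-1.
  rewrite prednK ?muln_gt0 ?k_gt0 ?prime_gt0 // iter_fmod_intr //.
  by apply/eqP; rewrite intr_Zpn_eq // (iter_grows_at_dvd _ _ p_prime).
apply/allP=> y; rewrite -fconnect_orbit => /iter_findex <-.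
rewrite iter_fmod_intr // reduce_intr // -iter_fmod_intr //.
by apply/(fcycle_mem_iter _ _ _ _ _ fs zs); eexists.
Qed.

(** The size divides p k because p k steps fix y modulo p^2. Conversely, closing modulo p makes it a
    multiple j k, and closing modulo p^2 forces p to divide j. *)
Lemma lift_size (t : seq 'Z_(p ^ 2)) : is_lift p 1 f s t -> size t = (p * k)%N.
Proof.
move=> lt; have /andP [ct /allP ts] := lt; have /and3P [t0 ut ft] := ct.
have yt := first_intr _ _ _ t0; set y := first p 2 t in yt.
have := ts _ yt; rewrite reduce_intr // => ys.
have gy := cycle_grows_at _ ys.
apply/eqP; rewrite eqn_dvd -!(is_cycle_iter_eq _ _ _ p2_gt1 _ _ _ ct yt).
rewrite (iter_grows_at_dvd _ _ p_prime _ _ _ gy) dvdnn /=.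
have := dvdnn (size t); rewrite -(is_cycle_iter_eq _ _ _ p2_gt1 _ _ _ ct yt).
move=> d2; have : (k %| size t)%N.
  rewrite -(is_cycle_iter_eq _ _ _ p1_gt1 _ _ _ s_cycle ys).
  by apply: dvdz_trans d2; rewrite exprS dvdz_mulr.
case/dvdnP=> j jE; move: d2.
by rewrite jE (iter_grows_at_dvd _ _ p_prime _ _ _ gy) => ?; rewrite dvdn_mul.
Qed.

Lemma lift_grows (t : seq 'Z_(p ^ 2)) : (3 < p)%N ->
  is_lift p 1 f s t -> grows p 2 f t.
Proof.
move=> p3 lt; have /andP [ct /allP ts] := lt; have /and3P [t0 ut ft] := ct.
apply/growsP => //; rewrite (lift_size _ lt); apply: grows_at_pmul => //.
apply: cycle_grows_at.
by rewrite -(reduce_intr p 1) // ts // first_intr.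
Qed.

(** Both lifts contain the class of the first element of [s], so both are rotations of its orbit. *)
Lemma lift_unique (t t' : seq 'Z_(p ^ 2)) :
  is_lift p 1 f s t -> is_lift p 1 f s t' -> exists i, t' = rot i t.
Proof.
move=> lt lt'; have s0 : s != [::] by case/and3P: s_cycle.
have xs := first_intr _ _ _ s0.
have xt := lift_mem _ _ lt xs; have xt' := lift_mem _ _ lt' xs.
have /andP [/and3P [_ ut ft] _] := lt; have /andP [/and3P [_ ut' ft'] _] := lt'.
have [i iE] := orbit_rot_cycle ft ut xt.
have [j jE] := orbit_rot_cycle ft' ut' xt'.
(* Rotating [t] by [i] gives the common orbit; rotating by [size t - j] then undoes the rotation of
   [t'] by [j]. *)
exists (rot_add t i (size t - j)); rewrite -rot_rot_add -iE jE.
have -> : size t = size (rot j t') by rewrite -jE iE size_rot.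
exact/esym/rotK.
Qed.

End Lift.

Close Scope ring_scope.

Theorem mainTheorem4 (p : nat) (p_prime : prime p) (p_gt3 : 3 < p)
  (f : {poly int}) (s : seq 'Z_(p ^ 1))
  (s_cycle : is_cycle p 1 f s) (s_grows : grows p 1 f s) :
  (exists t : seq 'Z_(p ^ 2),
     is_lift p 1 f s t /\
     (forall t' : seq 'Z_(p ^ 2),
        is_lift p 1 f s t' -> exists i : nat, t' = rot i t)) /\
  (forall t : seq 'Z_(p ^ 2), is_lift p 1 f s t -> grows p 2 f t).
Proof.
split=> [|t]; last exact: lift_grows.
have s0 : s != [::] by case/and3P: s_cycle.
have lt : is_lift p 1 f s (orbit (fmod p 2 f) (first p 1 s)%:~R%R).
  by apply: orbit_is_lift => //; apply: first_intr.
by eexists; split; [exact: lt | move=> t'; apply: lift_unique].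
Qed.
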